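(* Let $q\ge 2$ and let $(X,\|\cdot\|_X)$ be a Banach space with Rademacher cotype $q$. Then there is a constant $K\in(0,\infty)$, depending only on $q$ and on the Rademacher cotype $q$ constant $C_q(X)$, such that for every $n\in\mathbb{N}$, every integer $m\ge 6n^{1+\frac1q}$ which is divisible by $4$, and every $f:\mathbb{Z}_m^n\to X$, we have $$\sum_{j=1}^n\mathbb{E}_x\left[\left\|f\left(x+\frac m2 e_j\right)-f(x)\right\|_X^q\right]\le K\, m^q\,\mathbb{E}_{\varepsilon,x}\left[\left\|f(x+\varepsilon)-f(x)\right\|_X^q\right],$$ where $x$ is uniformly distributed on $\mathbb{Z}_m^n$ and $\varepsilon$ is uniformly distributed on $\{-1,0,1\}^n$ and independent of $x$.
   Context: $\mathbb{Z}_m=\mathbb{Z}/m\mathbb{Z}$, and $e_1,\dots,e_n$ is the standard basis of $\mathbb{Z}_m^n$; elements of $\{-1,0,1\}^n$ are regarded as elements of $\mathbb{Z}_m^n$. A Banach space $X$ has Rademacher cotype $q>0$ if there is $C<\infty$ such that for every $n\in\mathbb{N}$ and all $x_1,\dots,x_n\in X$, $$\sum_{j=1}^n\|x_j\|_X^q\le C^q\,\mathbb{E}_\varepsilon\left[\Big\|\sum_{j=1}^n\varepsilon_jx_j\Big\|_X^q\right],$$ where $\varepsilon$ is uniformly distributed on $\{-1,0,1\}^n$ (using $\{-1,1\}^n$ instead gives an equivalent notion). The smallest such $C$ is denoted $C_q(X)$. *)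

(* Defs.v *)
From HB Require Import structures.
From mathcomp Require Import all_boot all_order all_algebra.
From mathcomp Require Import all_classical all_reals all_analysis.

Set Implicit Arguments.
Unset Strict Implicit.
Unset Printing Implicit Defensive.

Import Order.TTheory GRing.Theory Num.Theory.
Import numFieldNormedType.Exports.

Local Open Scope classical_set_scope.
Local Open Scope ring_scope.

(* F t averaged over t uniformly distributed on T; for T a product type the two
   coordinates are independent and uniform. *)
Definition expect (R : realType) (T : finType) (F : T -> R) : R :=
  (\sum_(t : T) F t) / #|T|%:R.

Definition sign3 : finType := seq_sub [:: -1; 0; 1 : int].
Definition signs (n : nat) : finType := {ffun 'I_n -> sign3}.

Definition sign_val (n : nat) (eps : signs n) (j : 'I_n) : int := ssval (eps j).

(* 'Z_m is Z/mZ for 1 < m only ('Z_0 and 'Z_1 are Z/2Z). The condition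
   6 n^(1 + 1/q) <= m gives 6 <= m as soon as 0 < n; for n = 0 the row vectors
   have no entries and m plays no role. *)
Definition sign_vec (m n : nat) (eps : signs n) : 'rV['Z_m]_n :=
  \row_j (sign_val eps j)%:~R.

Definition cotype_bound (R : realType) (X : normedModType R) (q C : R) : Prop :=
  0 <= C /\
  forall (n : nat) (x : 'I_n -> X),
    \sum_(j < n) `|x j| `^ q <=
    C `^ q * expect (fun eps : signs n =>
                       `|\sum_(j < n) (sign_val eps j)%:~R *: x j| `^ q).

Definition has_cotype (R : realType) (X : normedModType R) (q : R) : Prop :=
  0 < q /\ exists C : R, cotype_bound X q C.

(* The infimum is attained when X has cotype q: see cotype_constP. *)
Definition cotype_const (R : realType) (X : normedModType R) (q : R) : R :=
  inf [set C : R | cotype_bound X q C].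

Lemma expect_ge0 (R : realType) (T : finType) (F : T -> R) :
  (forall t, 0 <= F t) -> 0 <= expect F.
Proof. by move=> F0; rewrite /expect divr_ge0 ?ler0n ?sumr_ge0. Qed.

Lemma cotype_constP (R : realType) (X : normedModType R) (q : R) :
  has_cotype X q -> cotype_bound X q (cotype_const X q).
Proof.
move=> [q0 [C0 HC0]].
have ne : [set C : R | cotype_bound X q C] !=set0 by exists C0.
have c0 : 0 <= cotype_const X q by apply: lb_le_inf => // C [].
split=> // n x; set E := expect _; set S := \sum_(j < n) _.
have E0 : 0 <= E by apply: expect_ge0 => t; exact: powR_ge0.
have S0 : 0 <= S by apply: sumr_ge0 => j _; exact: powR_ge0.
have [E_eq0|E_neq0] := eqVneq E 0.
  by move: (HC0.2 n x); rewrite -/E -/S E_eq0 !mulr0.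
have Epos : 0 < E by rewrite lt0r E_neq0.
rewrite -ler_pdivrMr //.
have SE0 : 0 <= S / E by rewrite divr_ge0.
have root_le C : cotype_bound X q C -> (S / E) `^ q^-1 <= C.
  move=> [C_ge0 /(_ n x)]; rewrite -/E -/S -ler_pdivrMr // => le.
  have := ge0_ler_powR (ltW (etrans (invr_gt0 q) q0)) SE0 (powR_ge0 C q) le.
  by rewrite -powRrM mulfV ?gt_eqF// powRr1.
have : (S / E) `^ q^-1 <= cotype_const X q by apply: lb_le_inf.
move/(ge0_ler_powR (ltW q0) (powR_ge0 _ _) c0).
by rewrite -powRrM mulVf ?gt_eqF// powRr1.
Qed.

(* Main.v *)
Require Import Defs.
From HB Require Import structures.
From mathcomp Require Import all_boot all_order all_algebra.
From mathcomp Require Import all_classical all_reals all_analysis.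
From mathcomp Require Import ring lra zify.

Set Implicit Arguments.
Unset Strict Implicit.
Unset Printing Implicit Defensive.

Import Order.TTheory GRing.Theory Num.Theory.
Import numFieldNormedType.Exports.

Local Open Scope ring_scope.

(** Why the inequality holds.

    Write T_j for the translation of functions on (Z/m)^n by e_j, |.| for the
    norm of L_q(eps, x), and D for the size |f(x + eps) - f(x)| of the right-hand
    side. If h is a function close to f, the increment of f over (m/2) e_j is at
    most 2 |h - f| plus the increment of h, and the latter is crossed in m/4
    steps of length 2. So it is enough to find one h such that |h - f| is of
    order n D, which the hypothesis on m makes affordable ([smoothed_cotype]),
    and such that the vectors T_j h - T_j^-1 h satisfy the cotype inequality
    with a right-hand side of order D ([smoothed_function]).

    Let M_j = (T_j + T_j^-1) / 2. For a sign vector eps consider the products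
    over j of the averaging operators p_j = M_j^2 + a_j and r_j = M_j^2 - a_j
    with a_j = eps_j M_j (T_j - T_j^-1) / 2. Both are an average of translations
    composed with the translation by +eps, respectively -eps; hence the
    difference of the two products, applied to f, has norm at most
    |f(x + eps) - f(x - eps)|, which is at most 2 D. On the other hand half of
    this difference is the odd part in eps of the product of the p_j, and its
    part of degree one is sum_j eps_j x_j with
    M_j x_j = (T_j - T_j^-1) / 2 applied to the product of all M_i^2 at f. Cotype
    bounds the norms of the x_j, hence those of the M_j x_j since M_j is a
    contraction ([linear_part_sum], [cotype_Lq]). It remains to discard the terms
    of degree at least three. Splitting off one coordinate at a time gives the exact recursions
    [even_error_cons] and [odd_error_cons]: the error of the odd part is a sum of
    at most n terms a_j applied to the error of the even part, which is itself a
    sum of at most n terms a_j applied to differences of shorter products. If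
    each a_j costs only 1/k, the total is at most (n/k)^2 D times a constant
    ([Lq_linear_part]), so any k >= n of the order of n will do.

    The factor 1/k comes from replacing f by S S f, with S a contraction
    commuting with all translations for which (T_j - T_j^-1) S has norm at most
    2/k for every j ([Lq_central_smoother]). For k = 3^a take S to be the
    composition over i < a of the averages of the translations by 2 * 3^i eta, eta
    uniform in {-1,0,1}^n. The gain in the coordinate j is the telescoping of
    (u - u^-1)(u^2 + 1 + u^-2) = u^3 - u^-3 over the scales u = T_j^(3^i), while
    |S f - f| is at most the sum of the step lengths 2 * 3^i, hence at most k D
    ([Lq_smoother]), because every step is a multiple of a uniform direction.
    Finally h is the product of the M_j^2 applied to S S f, and this last product
    moves f by at most 2 D: M_j^2 averages the translations by -2, 0 and 2 in
    the coordinate j with a law that is a mixture of the uniform one and of the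
    point mass at 0, so that the product is a mixture of averages of translations by 2 eta_A, eta uniform and A
    a set of coordinates ([Lq_mid]); and 2 eta_A is the sum of the two uniform
    vectors that agree with eta on A and are opposite outside A
    ([Lq_mask_double]). *)

(** * Finite averages and power means *)

Section Expectation.
Variable R : realType.

Lemma eq_expect (T : finType) (F G : T -> R) : F =1 G -> expect F = expect G.
Proof. by move=> FG; rewrite /expect; congr (_ / _); apply: eq_bigr. Qed.

Lemma expectD (T : finType) (F G : T -> R) :
  expect (fun t => F t + G t) = expect F + expect G.
Proof. by rewrite /expect big_split mulrDl. Qed.

Lemma expectZ (T : finType) (c : R) (F : T -> R) :
  expect (fun t => c * F t) = c * expect F.
Proof. by rewrite /expect -mulr_sumr mulrA. Qed.

Lemma le_expect (T : finType) (F G : T -> R) :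
  (forall t, F t <= G t) -> expect F <= expect G.
Proof. by move=> FG; rewrite /expect ler_wpM2r ?invr_ge0// ler_sum. Qed.

Lemma expect_reindex (T : finType) (h : T -> T) (F : T -> R) :
  injective h -> expect (F \o h) = expect F.
Proof. by move=> hI; rewrite /expect [in RHS](reindex_inj hI). Qed.

Lemma expect_pair (S T : finType) (F : S * T -> R) :
  expect F = expect (fun t => expect (fun s => F (s, t))).
Proof.
rewrite /expect -mulr_suml -mulrA card_prod natrM invfM; congr (_ * _).
by rewrite exchange_big pair_big/=; apply: eq_bigr => -[].
Qed.

Lemma expect_cst (T : finType) (t0 : T) (c : R) : expect (fun _ : T => c) = c.
Proof.
have T0 : (#|T|%:R : R) != 0.
  by rewrite pnatr_eq0 -lt0n; apply/card_gt0P; exists t0.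
by rewrite /expect sumr_const -[c *+ _]mulr_natr mulfK.
Qed.

Lemma expect_sum (I T : finType) (F : I -> T -> R) :
  \sum_i expect (F i) = expect (fun t => \sum_i F i t).
Proof. by rewrite /expect -mulr_suml exchange_big. Qed.

End Expectation.

Section PowerConvexity.
Variables (R : realType) (q : R).
Hypothesis q1 : 1 <= q.

Lemma powR_convex (t x y : R) : 0 <= t <= 1 -> 0 <= x -> 0 <= y ->
  (t * x + (1 - t) * y) `^ q <= t * x `^ q + (1 - t) * y `^ q.
Proof.
move=> /andP[t0 t1] x0 y0.
have := convex_powR q1 (Itv01 t0 t1) (x := x) (y := y).
by rewrite !inE/= !in_itv/= !andbT => /(_ x0 y0); rewrite !convRE.
Qed.

(** Jensen's inequality for the uniform distribution on the entries of [s]; a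
    new entry enters with weight 1 / (size s + 1), so two-point convexity
    suffices at each step. *)
Lemma powR_mean_seq (s : seq R) : all (>= 0) s ->
  ((\sum_(t <- s) t) / (size s)%:R) `^ q <= (\sum_(t <- s) t `^ q) / (size s)%:R.
Proof.
elim: s => [_|t s IH /= /andP[t0 s0]].
  by rewrite !big_nil !mul0r powR0// gt_eqF// (lt_le_trans _ q1).
rewrite !big_cons; set n := size s in IH *.
have n1 : (0 : R) < n.+1%:R by rewrite ltr0n.
have S0 : 0 <= \sum_(t <- s) t by rewrite big_seq sumr_ge0// => i /(allP s0).
have [n0|n0] := posnP n.
  have -> : s = [::] by apply: size0nil.
  by rewrite n0 !big_nil !addr0 !divr1.
have nn : (n%:R : R) != 0 by rewrite pnatr_eq0 -lt0n.
have nn1 : (n.+1%:R : R) != 0 by rewrite gt_eqF.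
pose c : R := n.+1%:R^-1.
have c01 : 0 <= c <= 1.
  by rewrite invr_ge0 ltW//= invf_le1// ler1n.
have cE : 1 - c = n%:R / n.+1%:R.
  by rewrite /c -natr1; field; rewrite natr1.
have M0 : 0 <= (\sum_(t <- s) t) / n%:R by rewrite divr_ge0.
have -> : (t + \sum_(j <- s) j) / n.+1%:R
    = c * t + (1 - c) * ((\sum_(j <- s) j) / n%:R).
  by rewrite cE /c; field; rewrite addrC natr1 nn1 nn.
apply: le_trans (powR_convex c01 t0 M0) _.
have -> : (t `^ q + \sum_(j <- s) j `^ q) / n.+1%:R
    = c * t `^ q + (1 - c) * ((\sum_(j <- s) j `^ q) / n%:R).
  by rewrite cE /c; field; rewrite addrC natr1 nn1 nn.
rewrite lerD2l ler_wpM2l ?IH//; lra.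
Qed.

Lemma powR_expect_le (T : finType) (F : T -> R) : (forall t, 0 <= F t) ->
  expect F `^ q <= expect (fun t => F t `^ q).
Proof.
move=> F0; have := @powR_mean_seq [seq F t | t : T].
rewrite size_image !big_image; apply.
by apply/allP => _ /mapP[t _ ->].
Qed.

Lemma powR_add_le (u v : R) : 0 <= u -> 0 <= v ->
  (u + v) `^ q <= 2 `^ q * (u `^ q + v `^ q).
Proof.
move=> u0 v0; have q0 : 0 <= q by exact: le_trans q1.
wlog uv : u v u0 v0 / u <= v.
  move=> H; have [/H|/ltW/H] := leP u v; first exact.
  by rewrite addrC [v `^ q + _]addrC; apply.
apply: (@le_trans _ _ ((2 * v) `^ q)).
  apply: ge0_ler_powR; rewrite ?nnegrE ?addr_ge0 ?mulr_ge0//.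
  by rewrite mulr_natl mulr2n lerD2r.
by rewrite powRM// ler_wpM2l ?powR_ge0// lerDr powR_ge0.
Qed.

End PowerConvexity.

(** * The normalised L_q norm of a function on a finite set *)

Section Lq.
Variables (R : realType) (q : R) (X : normedModType R).
Hypothesis q1 : 1 <= q.

Definition Lq (T : finType) (g : T -> X) : R :=
  (expect (fun t => `|g t| `^ q)) `^ q^-1.

Let q0 : 0 < q. Proof. exact: lt_le_trans q1. Qed.

Variable T : finType.
Implicit Types g h : T -> X.

Lemma Lq_ge0 g : 0 <= Lq g. Proof. exact: powR_ge0. Qed.

Lemma expect_pow_ge0 g : 0 <= expect (fun t => `|g t| `^ q).
Proof. by apply: expect_ge0 => t; exact: powR_ge0. Qed.

Lemma Lq_pow g : Lq g `^ q = expect (fun t => `|g t| `^ q).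
Proof.
by rewrite /Lq -powRrM mulVf ?gt_eqF// powRr1// expect_pow_ge0.
Qed.

Lemma powRK (a : R) : 0 <= a -> (a `^ q) `^ q^-1 = a.
Proof. by move=> a0; rewrite -powRrM mulfV ?gt_eqF// powRr1. Qed.

Lemma Lq_le (a : R) g : 0 <= a ->
  expect (fun t => `|g t| `^ q) <= a `^ q -> Lq g <= a.
Proof.
move=> a0 ga; rewrite -[leRHS]powRK//; apply: ge0_ler_powR => //.
- by rewrite invr_ge0 ltW.
- by rewrite nnegrE expect_pow_ge0.
- by rewrite nnegrE powR_ge0.
Qed.

Lemma Lq_mono g h : (forall t, `|g t| <= `|h t|) -> Lq g <= Lq h.
Proof.
move=> gh; apply: Lq_le; first exact: Lq_ge0.
rewrite Lq_pow; apply: le_expect => t.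
by apply: ge0_ler_powR; rewrite ?nnegrE// ltW.
Qed.

Lemma Lq_reindex (f : T -> T) g : injective f -> Lq (g \o f) = Lq g.
Proof.
by move=> fI; rewrite /Lq -(expect_reindex (fun t => `|g t| `^ q) fI).
Qed.

Lemma Lq0 : Lq (0 : T -> X) = 0.
Proof.
rewrite /Lq /expect big1 => [|t _]; last by rewrite normr0 powR0// gt_eqF.
by rewrite mul0r powR0// gt_eqF// invr_gt0.
Qed.

Lemma LqZ (c : R) g : Lq (c *: g) = `|c| * Lq g.
Proof.
rewrite /Lq (eq_expect (G := fun t => `|c| `^ q * `|g t| `^ q)); last first.
  by move=> t; rewrite normrZ powRM.
by rewrite expectZ powRM ?powR_ge0 ?expect_pow_ge0// powRK.
Qed.

Lemma LqN g : Lq (- g) = Lq g.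
Proof. by rewrite -scaleN1r LqZ normrN normr1 mul1r. Qed.

(** Minkowski's inequality: the unit ball of [Lq] is convex because t^q is, and
    dividing by numbers slightly larger than the two norms moves both functions
    into it. *)
Lemma LqD g h : Lq (g + h) <= Lq g + Lq h.
Proof.
apply/ler_addgt0Pr => e e0.
pose a := Lq g + e / 2; pose b := Lq h + e / 2.
have ga : Lq g < a by rewrite ltrDl divr_gt0.
have hb : Lq h < b by rewrite ltrDl divr_gt0.
have a0 : 0 < a by apply: le_lt_trans ga; exact: Lq_ge0.
have b0 : 0 < b by apply: le_lt_trans hb; exact: Lq_ge0.
have -> : Lq g + Lq h + e = a + b by rewrite /a /b addrACA -splitr.
clearbody a b.
have ab0 : 0 < a + b by rewrite addr_gt0.
have an0 : a != 0 by rewrite gt_eqF.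
have bn0 : b != 0 by rewrite gt_eqF.
have abn0 : a + b != 0 by rewrite gt_eqF.
have ball c (k : T -> X) : 0 < c -> Lq k < c ->
    expect (fun t => (`|k t| / c) `^ q) <= 1.
  move=> c0 kc; rewrite (eq_expect (G := fun t => c^-1 `^ q * `|k t| `^ q)).
    rewrite expectZ -(Lq_pow k) -powRM ?invr_ge0 ?Lq_ge0 ?(ltW c0)//.
    have -> : 1 = 1 `^ q :> R by rewrite powR1.
    apply: ge0_ler_powR; first exact: ltW.
    - by rewrite nnegrE mulr_ge0 ?invr_ge0 ?Lq_ge0// ltW.
    - by rewrite nnegrE.
    - by rewrite mulrC ler_pdivrMr// mul1r ltW.
  by move=> t; rewrite powRM ?invr_ge0 ?(ltW c0)// mulrC.
apply: Lq_le; first exact: ltW.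
rewrite -[leRHS]mulr1 -ler_pdivrMl ?powR_gt0//.
pose c := a / (a + b).
have c01 : 0 <= c <= 1.
  by rewrite /c divr_ge0 ?(ltW a0) ?(ltW ab0)//= ler_pdivrMr// mul1r lerDl ltW.
have cE : 1 - c = b / (a + b) by rewrite /c; field.
apply: (@le_trans _ _
    (expect (fun t => c * (`|g t| / a) `^ q + (1 - c) * (`|h t| / b) `^ q))).
  rewrite -expectZ; apply: le_expect => t.
  have ga0 : 0 <= `|g t| / a by rewrite divr_ge0// ltW.
  have hb0 : 0 <= `|h t| / b by rewrite divr_ge0// ltW.
  apply: le_trans (powR_convex q1 c01 ga0 hb0).
  have -> : ((a + b) `^ q)^-1 = (a + b)^-1 `^ q.
    rewrite -(@powR_inv1 _ ((a + b) `^ q)) ?powR_ge0//.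
    rewrite -(@powR_inv1 _ (a + b)) ?(ltW ab0)//.
    by rewrite -!powRrM mulrC.
  rewrite -powRM ?invr_ge0 ?(ltW ab0)//; apply: ge0_ler_powR; first exact: ltW.
  - by rewrite nnegrE mulr_ge0// invr_ge0 ltW.
  - move: c01 => /andP[c0 c1].
    by rewrite nnegrE addr_ge0// mulr_ge0// subr_ge0.
  have -> : c * (`|g t| / a) + (1 - c) * (`|h t| / b)
      = (a + b)^-1 * (`|g t| + `|h t|).
    rewrite cE /c; move: (`|g t|) (`|h t|) => u v.
    by field; rewrite abn0 bn0 an0.
  by rewrite ler_wpM2l ?invr_ge0 ?(ltW ab0)// ler_normD.
rewrite expectD !expectZ.
have := ball _ _ a0 ga; have := ball _ _ b0 hb; have /andP[c0 c1] := c01.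
move: (expect _) (expect _) => u v u1 v1; clear -u1 v1 c0 c1; nra.
Qed.

Lemma Lq_sum (I : Type) (r : seq I) (P : pred I) (F : I -> T -> X) :
  Lq (\sum_(i <- r | P i) F i) <= \sum_(i <- r | P i) Lq (F i).
Proof.
elim/big_ind2: _ => [|a b c d ab cd|//]; first by rewrite Lq0.
by apply: le_trans (LqD _ _) _; exact: lerD.
Qed.

Lemma LqB g h : Lq (g - h) <= Lq g + Lq h.
Proof. by rewrite -(LqN h); exact: LqD. Qed.

Lemma Lq_triangle h g k : Lq (g - k) <= Lq (g - h) + Lq (h - k).
Proof. by rewrite -[g - k](subrKA h); exact: LqD. Qed.

End Lq.

(** * Random signs *)

Section Signs.
Variable n : nat.

Definition neg3 (a : sign3) : sign3 := insubd a (- ssval a).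

Lemma sign3P (a : sign3) : [\/ ssval a = -1, ssval a = 0 | ssval a = 1].
Proof.
have := ssvalP a; rewrite !inE.
by case/or3P => /eqP ->; [constructor 1|constructor 2|constructor 3].
Qed.

Lemma ssval_neg3 a : ssval (neg3 a) = - ssval a.
Proof. by rewrite val_insubd; case: (sign3P a) => ->. Qed.

Lemma neg3K : involutive neg3.
Proof. by move=> a; apply: val_inj; rewrite /= !ssval_neg3 opprK. Qed.

Lemma card_sign3 : #|sign3| = 3.
Proof. by rewrite card_seq_sub. Qed.

Lemma sum_sign3 (V : nmodType) (F : int -> V) :
  \sum_(a : sign3) F (ssval a) = F (-1) + F 0 + F 1.
Proof.
have mem_m : -1 \in [:: -1; 0; 1 : int] by [].
have mem_0 : 0 \in [:: -1; 0; 1 : int] by [].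
have mem_p : 1 \in [:: -1; 0; 1 : int] by [].
rewrite (bigD1 (SeqSub mem_m)) //= (bigD1 (SeqSub mem_0)) //=.
rewrite (bigD1 (SeqSub mem_p)) //= big1 ?addr0 ?addrA// => a.
rewrite -!(inj_eq val_inj)/=.
by case: (sign3P a) => ->.
Qed.

Definition sign_zero : signs n :=
  [ffun=> SeqSub (isT : 0 \in [:: -1; 0; 1 : int])].

Definition flip (A : {set 'I_n}) (eps : signs n) : signs n :=
  [ffun j => if j \in A then eps j else neg3 (eps j)].

Lemma flipK A : involutive (flip A).
Proof.
by move=> eps; apply/ffunP => j; rewrite !ffunE; case: (j \in A); rewrite ?neg3K.
Qed.

Definition set_sign (eps : signs n) (l : 'I_n) (a : sign3) : signs n :=
  [ffun j => if j == l then a else eps j].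

(** Exchanging the independent sign with the coordinate [l] is an involution of
    the pairs (sign, signs): the coordinates of uniform signs are independent. *)
Lemma sum_resample (V : nmodType) (l : 'I_n) (F : sign3 -> signs n -> V) :
  (forall a b eps, F a (set_sign eps l b) = F a eps) ->
  \sum_a \sum_eps F a eps = (\sum_(eps : signs n) F (eps l) eps) *+ 3.
Proof.
move=> FE; pose h (p : sign3 * signs n) := (p.2 l, set_sign p.2 l p.1).
have hK : involutive h.
  move=> [a eps]; rewrite /h /=; congr (_, _); first by rewrite ffunE eqxx.
  by apply/ffunP => j; rewrite !ffunE; case: eqP => [->|].
transitivity (\sum_(a : sign3) \sum_(eps : signs n) F (eps l) eps).
  rewrite !pair_big /= (reindex_inj (inv_inj hK)) /=.
  by apply: eq_bigr => p _; rewrite FE.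
by rewrite sumr_const card_sign3.
Qed.

End Signs.

(** * Averages of translations *)

Section Translations.
Variables (R : realType) (q : R) (X : normedModType R) (n m : nat).
Hypothesis q1 : 1 <= q.

Local Notation point := 'rV['Z_m]_n.
Local Notation fn := (signs n * point -> X).
Local Notation N := (@Lq R q X (signs n * point)%type).

Implicit Types (v : signs n -> point) (g h : fn) (A B : fn -> fn).

(** The vector may depend on the signs, so that the random translation of a walk
    is one isometry of [Lq] over pairs of signs and points. *)
Definition shift v g : fn := fun w => g (w.1, w.2 + v w.1).

Definition sign_mul (c : signs n -> R) g : fn := fun w => c w.1 *: g w.

Definition mean (I : finType) (v : I -> signs n -> point) g : fn :=
  #|I|%:R^-1 *: \sum_(i : I) shift (v i) g.

Definition two_point v g : fn := 2^-1 *: (shift v g + shift (- v) g).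

Definition central v g : fn := 2^-1 *: (shift v g - shift (- v) g).

(** An inductive closure, so that linearity, contraction and commutation need only
    be checked for a single average and pass to all compositions. *)
Inductive averaging : (fn -> fn) -> Prop :=
| averaging_id : averaging id
| averaging_mean (I : finType) (i0 : I) (v : I -> signs n -> point) :
    averaging (mean v)
| averaging_comp A B : averaging A -> averaging B -> averaging (A \o B).

Lemma shiftD v g h : shift v (g + h) = shift v g + shift v h.
Proof. by []. Qed.

Lemma shiftB v g h : shift v (g - h) = shift v g - shift v h.
Proof. by []. Qed.

Lemma shiftZ v c g : shift v (c *: g) = c *: shift v g.
Proof. by []. Qed.

Lemma shift_sum v (I : finType) (F : I -> fn) :
  shift v (\sum_i F i) = \sum_i shift v (F i).
Proof. by apply/funext => w; rewrite /shift !fct_sumE. Qed.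

Lemma shift_shift u v g : shift u (shift v g) = shift (u + v) g.
Proof. by apply/funext => w; rewrite /shift/= addrA. Qed.

Lemma shift0 g : shift 0 g = g.
Proof. by apply/funext => -[e x]; rewrite /shift/= addr0. Qed.

Lemma shiftC u v g : shift u (shift v g) = shift v (shift u g).
Proof. by rewrite !shift_shift addrC. Qed.

Lemma Lq_shift v g : N (shift v g) = N g.
Proof.
have fI : injective (fun w : signs n * point => (w.1, w.2 + v w.1)).
  by move=> [e x] [e' x'] [<-] /addIr <-.
by rewrite -(Lq_reindex q g fI).
Qed.

Lemma averaging_shift v : averaging (shift v).
Proof.
have -> : shift v = @mean unit (fun=> v).
  apply/funext => g; rewrite /mean card_unit invr1 scale1r.
  by rewrite (big_pred1 tt)// => -[].
exact: (averaging_mean tt).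
Qed.

Lemma averaging_two_point v : averaging (two_point v).
Proof.
have -> : two_point v = @mean bool (fun b => if b then v else - v).
  by apply/funext => g; rewrite /two_point /mean card_bool big_bool.
exact: (averaging_mean true).
Qed.

Section AveragingTheory.
Variable A : fn -> fn.
Hypothesis avA : averaging A.

Lemma averagingD g h : A (g + h) = A g + A h.
Proof.
elim: avA g h => [//|I i0 v|B C _ IHB _ IHC] g h; last by rewrite /= IHC IHB.
by rewrite /mean -scalerDr -big_split.
Qed.

Lemma averagingZ c g : A (c *: g) = c *: A g.
Proof.
elim: avA g => [//|I i0 v|B C _ IHB _ IHC] g; last by rewrite /= IHC IHB.
by rewrite /mean scalerA mulrC -scalerA; congr (_ *: _); rewrite scaler_sumr.
Qed.

Lemma averagingB g h : A (g - h) = A g - A h.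
Proof. by rewrite averagingD -scaleN1r averagingZ scaleN1r. Qed.

Lemma averaging0 : A 0 = 0.
Proof. by rewrite -(scale0r 0) averagingZ !scale0r. Qed.

Lemma averaging_sign c g : A (sign_mul c g) = sign_mul c (A g).
Proof.
elim: avA g => [//|I i0 v|B C _ IHB _ IHC] g; last by rewrite /= IHC IHB.
apply/funext => w; rewrite /mean /sign_mul !fctE scalerA mulrC -scalerA.
by congr (_ *: _); rewrite !fct_sumE scaler_sumr.
Qed.

Lemma averagingC_shift v g : A (shift v g) = shift v (A g).
Proof.
elim: avA g => [//|I i0 u|B C _ IHB _ IHC] g; last by rewrite /= IHC IHB.
rewrite /mean shiftZ shift_sum; congr (_ *: _).
by apply: eq_bigr => i _; rewrite shiftC.
Qed.

Lemma averaging_sum (I : finType) (F : I -> fn) :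
  A (\sum_i F i) = \sum_i A (F i).
Proof.
exact: (big_morph A averagingD averaging0).
Qed.

Lemma averagingC B g : averaging B -> A (B g) = B (A g).
Proof.
move=> avB; elim: avB g => [//|I i0 u|B' C _ IHB _ IHC] g; last first.
  by rewrite /= IHB IHC.
rewrite /mean averagingZ averaging_sum; congr (_ *: _).
by apply: eq_bigr => i _; rewrite averagingC_shift.
Qed.

Lemma averaging_central v g : A (central v g) = central v (A g).
Proof. by rewrite /central averagingZ averagingB !averagingC_shift. Qed.

Lemma Lq_averaging g : N (A g) <= N g.
Proof.
elim: avA g => [//|I i0 v|B C _ IHB _ IHC] g; last first.
  exact: le_trans (IHB _) (IHC _).
have I0 : (0 : R) < #|I|%:R by rewrite ltr0n; apply/card_gt0P; exists i0.
rewrite /mean LqZ// ger0_norm ?invr_ge0 ?(ltW I0)// ler_pdivrMl//.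
apply: le_trans (Lq_sum q1 _ _ _) _.
rewrite (eq_bigr (fun=> N g)) => [|i _]; last exact: Lq_shift.
by rewrite sumr_const -[leLHS]mulr_natl.
Qed.

End AveragingTheory.

Lemma Lq_sign_mul c g : (forall e, `|c e| <= 1) -> N (sign_mul c g) <= N g.
Proof.
move=> c1; apply: Lq_mono => // w; rewrite normrZ.
by rewrite ler_piMl.
Qed.

Lemma Lq_central v g : N (central v g) <= N g.
Proof.
rewrite /central LqZ// gtr0_norm ?invr_gt0// ler_pdivrMl//.
apply: le_trans (LqB q1 _ _) _.
by rewrite !Lq_shift mulr_natl mulr2n.
Qed.

Definition sign_free g := forall e e' x, g (e, x) = g (e', x).

End Translations.

(** * The odd part of a walk *)

Section Walk.
Variables (R : realType) (q : R) (X : normedModType R) (n m : nat).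
Hypothesis q1 : 1 <= q.

Local Notation point := 'rV['Z_m]_n.
Local Notation fn := (signs n * point -> X).
Local Notation N := (@Lq R q X (signs n * point)%type).

Implicit Types (g h : fn) (j : 'I_n) (s : seq 'I_n).

Definition basis j : point := delta_mx 0 j.

Definition sign_of j (eps : signs n) : R := (sign_val eps j)%:~R.

Definition sign_dir j (eps : signs n) : point := basis j *~ sign_val eps j.

(** A symmetric step in the coordinates where the sign vanishes. It gives the
    average of [step] over the two directions the same value for all three signs,
    which keeps the vectors of [linear_part_sum] independent of the signs. *)
Definition zero_dir j (eps : signs n) : point :=
  if sign_val eps j == 0 then basis j else 0.

Definition mid1 j g : fn := two_point (fun=> basis j) g.
Definition central1 j g : fn := central (fun=> basis j) g.
Definition odd1 j g : fn := sign_mul (sign_of j) (central1 j g).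
Definition step j (v : signs n -> point) g : fn :=
  mid1 j (two_point (zero_dir j) (shift v g)).

Lemma norm_sign_of j eps : `|sign_of j eps| <= 1.
Proof.
rewrite /sign_of /sign_val; case: (sign3P (eps j)) => ->.
- by rewrite mulrNz normrN normr1.
- by rewrite normr0.
- by rewrite normr1.
Qed.

Lemma two_point_same (x : X) : 2^-1 *: (x + x) = x.
Proof.
by rewrite -{1 2}[x]scale1r -scalerDl scalerA mulVf ?scale1r// pnatr_eq0.
Qed.

Lemma two_point_half (x y : X) : 2^-1 *: (x + y) + 2^-1 *: (x - y) = x.
Proof. by rewrite -scalerDr addrACA subrr addr0 two_point_same. Qed.

Lemma two_point_half' (x y : X) : 2^-1 *: (x + y) - 2^-1 *: (x - y) = y.
Proof. by rewrite -scalerN opprB [x + y]addrC two_point_half. Qed.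

Lemma step_forward j g :
  step j (sign_dir j) g = mid1 j (mid1 j g + odd1 j g).
Proof.
congr (mid1 j _); apply/funext => -[eps x].
rewrite /odd1 /mid1 /central1 /sign_mul /two_point /central /shift !fctE /=.
rewrite /zero_dir /sign_dir /sign_of /sign_val; case: (sign3P (eps j)) => -> /=.
- rewrite mulrNz !mulr1z !scaleN1r oppr0 !addr0 two_point_same.
  by rewrite two_point_half'.
- by rewrite !mulr0z !addr0 scale0r addr0.
- rewrite !mulr1z !scale1r oppr0 !addr0 two_point_same.
  by rewrite two_point_half.
Qed.

Lemma step_backward j g :
  step j (- sign_dir j) g = mid1 j (mid1 j g - odd1 j g).
Proof.
congr (mid1 j _); apply/funext => -[eps x].
rewrite /odd1 /mid1 /central1 /sign_mul /two_point /central /shift !fctE /=.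
rewrite /zero_dir /sign_dir /sign_of /sign_val; case: (sign3P (eps j)) => -> /=.
- rewrite mulrNz !mulr1z !scaleN1r oppr0 opprK !addr0 two_point_same.
  by rewrite opprK two_point_half.
- by rewrite !mulr0z !oppr0 !addr0 scale0r subr0.
- rewrite !mulr1z !scale1r oppr0 !addr0 two_point_same.
  by rewrite two_point_half'.
Qed.

Definition forward s g : fn := foldr (fun j => step j (sign_dir j)) g s.
Definition backward s g : fn := foldr (fun j => step j (- sign_dir j)) g s.
Definition mid s g : fn := foldr (fun j h => mid1 j (mid1 j h)) g s.

(** The part of degree one in the signs of the expansion of [forward]. *)
Fixpoint linear_part s g : fn :=
  if s is j :: s' then
    mid1 j (odd1 j (mid s' g) + mid1 j (linear_part s' g))
  else 0.

Definition walk_dir s : signs n -> point := \sum_(j <- s) sign_dir j.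

Lemma averaging_mid1 j : averaging (@mid1 j).
Proof. exact: averaging_two_point. Qed.

Lemma averaging_mid s : averaging (mid s).
Proof.
elim: s => [|j s IH]; first exact: averaging_id.
apply: (averaging_comp (A := mid1 j \o mid1 j)) IH.
exact: (averaging_comp (averaging_mid1 j) (averaging_mid1 j)).
Qed.

(** The translation part of each step commutes with the averaging of the other
    steps, so all translations can be made at once, before any averaging. *)
Lemma walk_factor s : exists2 A : fn -> fn, averaging A &
  forall g, forward s g = A (shift (walk_dir s) g) /\
            backward s g = A (shift (- walk_dir s) g).
Proof.
elim: s => [|j s [A avA AE]].
  exists id; first exact: averaging_id.
  by move=> g; rewrite /walk_dir big_nil oppr0 shift0.
pose B : fn -> fn := mid1 j \o two_point (zero_dir j).
have avB : averaging B.
  by apply: averaging_comp; [exact: averaging_mid1|exact: averaging_two_point].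
exists (B \o A); first exact: averaging_comp.
move=> g; have [fE bE] := AE g; rewrite /walk_dir big_cons /= fE bE opprD.
rewrite -(shift_shift (sign_dir j)) -(shift_shift (- sign_dir j)).
by rewrite !(averagingC_shift avA).
Qed.

Lemma averaging_forward s : averaging (forward s).
Proof.
have [A avA AE] := walk_factor s.
have -> : forward s = A \o shift (walk_dir s).
  by apply/funext => g; rewrite (AE g).1.
exact: averaging_comp avA (averaging_shift _ _).
Qed.

Lemma averaging_backward s : averaging (backward s).
Proof.
have [A avA AE] := walk_factor s.
have -> : backward s = A \o shift (- walk_dir s).
  by apply/funext => g; rewrite (AE g).2.
exact: averaging_comp avA (averaging_shift _ _).
Qed.

Lemma Lq_forward_backward s g :
  N (forward s g - backward s g) <=
  N (shift (walk_dir s) g - shift (- walk_dir s) g).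
Proof.
have [A avA AE] := walk_factor s; have [-> ->] := AE g.
by rewrite -(averagingB avA); exact: (Lq_averaging q1 avA).
Qed.

Lemma odd1D j g h : odd1 j (g + h) = odd1 j g + odd1 j h.
Proof.
apply/funext => w; rewrite /odd1 /central1 /central /sign_mul shiftD [in LHS]shiftD.
rewrite !fctE -scalerDr; congr (_ *: _); rewrite -scalerDr; congr (_ *: _).
by rewrite opprD addrACA.
Qed.

Lemma odd1Z j c g : odd1 j (c *: g) = c *: odd1 j g.
Proof.
apply/funext => w; rewrite /odd1 /central1 /central /sign_mul !shiftZ !fctE.
by rewrite -scalerBr !scalerA; congr (_ *: _); ring.
Qed.

Lemma odd1B j g h : odd1 j (g - h) = odd1 j g - odd1 j h.
Proof. by rewrite -scaleN1r odd1D odd1Z scaleN1r. Qed.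

(** [even_error] and [odd_error] collect the terms of even degree at least two,
    respectively of odd degree at least three, in the signs. *)
Definition even_error s g := 2^-1 *: (forward s g + backward s g) - mid s g.
Definition odd_error s g :=
  2^-1 *: (forward s g - backward s g) - linear_part s g.

(** Only the difference of the two walks enters, and it is controlled by an
    increment of the original function. *)
Lemma even_error_cons j s g : even_error (j :: s) g =
  mid1 j (mid1 j (even_error s g)
          + 2^-1 *: odd1 j (forward s g - backward s g)).
Proof.
have avM := averaging_mid1 j.
rewrite /even_error /= step_forward step_backward odd1B.
set P := forward s g; set Q := backward s g; set W := mid s g.
rewrite -(averagingD avM) -(averagingZ avM) -(averagingB avM); congr mid1.
rewrite (averagingB avM) (averagingZ avM) (averagingD avM).
by rewrite addrACA scalerDr addrAC.
Qed.

Lemma odd_error_cons j s g : odd_error (j :: s) g =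
  mid1 j (mid1 j (odd_error s g) + odd1 j (even_error s g)).
Proof.
have avM := averaging_mid1 j.
rewrite /odd_error /even_error /= step_forward step_backward odd1B odd1Z odd1D.
set P := forward s g; set Q := backward s g; set W := mid s g.
rewrite -(averagingB avM) -(averagingZ avM) -(averagingB avM); congr mid1.
rewrite !(averagingB avM) (averagingZ avM) (averagingB avM).
rewrite opprB [odd1 j Q - _]addrC addrACA scalerDr.
by rewrite [odd1 j W + _]addrC opprD addrACA.
Qed.

Lemma Lq_odd1 j g : N (odd1 j g) <= N (central1 j g).
Proof. by apply: (Lq_sign_mul q1) => e; exact: norm_sign_of. Qed.

Lemma averaging_even_error A s g :
  averaging A -> A (even_error s g) = even_error s (A g).
Proof.
move=> avA; rewrite /even_error averagingB// averagingZ// averagingD//.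
by rewrite !(averagingC avA _ (averaging_forward s))
  !(averagingC avA _ (averaging_backward s)) !(averagingC avA _ (averaging_mid s)).
Qed.

Lemma even_error_nil g : even_error [::] g = 0.
Proof.
by apply/funext => w; rewrite /even_error !fctE /= two_point_same subrr.
Qed.

Lemma odd_error_nil g : odd_error [::] g = 0.
Proof. by rewrite /odd_error/= subrr scaler0 subr0. Qed.

Section SmoothedWalk.
Variables (S : fn -> fn) (kappa delta : R) (f : fn).
Hypotheses (avS : averaging S) (k0 : 0 <= kappa) (d0 : 0 <= delta).
Hypothesis S_smooth : forall j g, N (central1 j (S g)) <= kappa * N g.
Hypothesis f_dir : forall s, uniq s ->
  N (shift (walk_dir s) f - shift (- walk_dir s) f) <= delta.

Lemma Lq_even_error s : uniq s ->
  N (even_error s (S f)) <= (size s)%:R * kappa * delta.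
Proof.
elim: s => [_|j s IH /andP[_ us]]; first by rewrite even_error_nil Lq0// !mul0r.
rewrite even_error_cons; apply: le_trans (Lq_averaging q1 (averaging_mid1 j) _) _.
apply: le_trans (LqD q1 _ _) _; rewrite [size _]/= -[(size s).+1%:R]natr1 !mulrDl mul1r.
apply: lerD.
  exact: le_trans (Lq_averaging q1 (averaging_mid1 j) _) (IH us).
rewrite (averagingC (averaging_forward s) _ avS).
rewrite (averagingC (averaging_backward s) _ avS) -averagingB//.
rewrite LqZ// gtr0_norm ?invr_gt0//.
set h := forward s f - backward s f.
have hd : N h <= delta by exact: le_trans (Lq_forward_backward _ _) (f_dir us).
have oh : N (odd1 j (S h)) <= kappa * delta.
  apply: le_trans (Lq_odd1 _ _) _; apply: le_trans (S_smooth _ _) _.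
  by rewrite ler_wpM2l.
apply: le_trans oh; rewrite ler_pdivrMl//.
by rewrite ler_peMl ?Lq_ge0// ler1n.
Qed.

Lemma Lq_odd_error s : uniq s ->
  N (odd_error s (S (S f))) <= ((size s)%:R * kappa) ^+ 2 * delta.
Proof.
elim: s => [_|j s IH /andP[_ us]].
  by rewrite odd_error_nil Lq0// mul0r expr0n mul0r.
rewrite odd_error_cons; apply: le_trans (Lq_averaging q1 (averaging_mid1 j) _) _.
apply: le_trans (LqD q1 _ _) _; rewrite [size _]/=.
apply: (@le_trans _ _ (((size s)%:R * kappa) ^+ 2 * delta
                       + kappa * ((size s)%:R * kappa * delta))).
  apply: lerD.
    exact: le_trans (Lq_averaging q1 (averaging_mid1 j) _) (IH us).
  apply: le_trans (Lq_odd1 _ _) _; rewrite -averaging_even_error//.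
  apply: le_trans (S_smooth _ _) _.
  by rewrite ler_wpM2l// Lq_even_error.
rewrite -[(size s).+1%:R]natr1; have := ler0n R (size s); move: (size s)%:R => z z0.
rewrite mulrA -mulrDl ler_wpM2r//.
by rewrite -subr_ge0 (_ : _ - _ = kappa * kappa * (z + 1)); [nra|ring].
Qed.

(** Each of the two applications of [S] pays for one of the two factors [odd1]
    in the error, hence the square of [size s * kappa]. *)
Lemma Lq_linear_part s : uniq s ->
  N (linear_part s (S (S f))) <= (1 + ((size s)%:R * kappa) ^+ 2) * delta.
Proof.
move=> us; set g := S (S f).
have -> : linear_part s g =
    2^-1 *: (forward s g - backward s g) - odd_error s g.
  by rewrite /odd_error opprB addrCA subrr addr0.
apply: le_trans (LqB q1 _ _) _; rewrite mulrDl mul1r; apply: lerD; last first.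
  exact: Lq_odd_error.
rewrite LqZ// gtr0_norm ?invr_gt0// ler_pdivrMl//.
have Dg : forward s g - backward s g = S (S (forward s f - backward s f)).
  rewrite !averagingB// /g.
  by rewrite !(averagingC (averaging_forward s) _ avS)
    !(averagingC (averaging_backward s) _ avS).
rewrite Dg; do 2![apply: le_trans (Lq_averaging q1 avS _) _].
apply: le_trans (Lq_forward_backward _ _) _; apply: le_trans (f_dir us) _.
by rewrite ler_peMl// ler1n.
Qed.

End SmoothedWalk.

Lemma sign_free_mid1 j g : sign_free g -> sign_free (mid1 j g).
Proof. by move=> gf e e' x; rewrite /mid1 /two_point /shift !fctE !(gf e e'). Qed.

Lemma sign_free_central1 j g : sign_free g -> sign_free (central1 j g).
Proof. by move=> gf e e' x; rewrite /central1 /central /shift !fctE !(gf e e'). Qed.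

Lemma sign_free_mid s g : sign_free g -> sign_free (mid s g).
Proof. by move=> gf; elim: s => //= j s IH; do 2!apply: sign_free_mid1. Qed.

(** The vectors to which cotype is applied. They carry one factor [mid1 j] less
    than the others in the coordinate [j]; applying it turns them into the central
    differences of a single function. *)
Lemma linear_part_sum s g : uniq s -> sign_free g ->
  exists x : 'I_n -> fn, [/\ forall j, sign_free (x j),
    linear_part s g = \sum_(j <- s) sign_mul (sign_of j) (x j) &
    forall j, j \in s -> mid1 j (x j) = central1 j (mid s g)].
Proof.
move=> us gf; elim: s us => [_|j s IH /andP[js us]].
  by exists (fun=> 0); split=> //; rewrite big_nil.
have [x [xf lE xE]] := IH us; have avM := averaging_mid1.
exists (fun i => if i == j then mid1 j (central1 j (mid s g))
                 else mid1 j (mid1 j (x i))); split=> [i||i].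
- case: ifP => _; last by do 2!apply: sign_free_mid1.
  by apply/sign_free_mid1/sign_free_central1/sign_free_mid.
- rewrite big_cons eqxx /= (averagingD (avM j)) lE; congr (_ + _).
    by rewrite (averaging_sign (avM j)).
  rewrite !(big_morph (mid1 j) (averagingD (avM j)) (averaging0 (avM j))).
  apply: eq_big_seq => i si.
  rewrite ifN; last by apply: contraNneq js => <-.
  by rewrite !(averaging_sign (avM j)).
- rewrite inE; case: eqVneq => [-> _|ij /= si] /=.
    by rewrite /central1 !(averaging_central (avM j)).
  rewrite 2!(averagingC (avM i) _ (avM j)) (xE _ si).
  by rewrite /central1 !(averaging_central (avM j)).
Qed.

End Walk.

(** * Increments along random directions *)

Section Increments.
Variables (R : realType) (q : R) (X : normedModType R) (n m : nat).
Hypothesis q1 : 1 <= q.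

Local Notation point := 'rV['Z_m]_n.
Local Notation fn := (signs n * point -> X).
Local Notation N := (@Lq R q X (signs n * point)%type).

Local Notation fullset := [set: 'I_n]%SET.

Implicit Types (g h f : fn) (j : 'I_n) (A : {set 'I_n}).

Definition mask_dir A : signs n -> point :=
  fun eps => \sum_(j in A) sign_dir m j eps.

Definition increment f : R := N (shift (mask_dir fullset) f - f).

Lemma increment_ge0 f : 0 <= increment f.
Proof. exact: Lq_ge0. Qed.

Lemma mask_dirT : mask_dir fullset = sign_vec m (n := n).
Proof.
apply/funext => eps; apply/rowP => i; rewrite /mask_dir summxE mxE.
rewrite (bigD1 i) ?inE//= big1 => [|k /andP[_ ki]].
  by rewrite addr0 /sign_dir /basis -scaler_int !mxE !eqxx mulr1.
rewrite /sign_dir /basis -scaler_int !mxE eqxx /= eq_sym (negbTE ki).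
by rewrite mulr0.
Qed.

Lemma walk_dirE s : uniq s -> walk_dir m s = mask_dir [set j in s]%SET.
Proof.
move=> us; apply/funext => eps; rewrite /walk_dir fct_sumE /mask_dir.
by rewrite big_uniq//; apply: eq_bigl => j; rewrite inE.
Qed.

Lemma mask_dirU1 A l : l \notin A ->
  mask_dir (l |: A)%SET = sign_dir m l + mask_dir A.
Proof. by move=> lA; apply/funext => eps; rewrite /mask_dir big_setU1. Qed.

Lemma shift_telescope u v f :
  shift (u + v) f - f = shift v (shift u f - f) + (shift v f - f).
Proof. by rewrite shiftB shift_shift [v + u]addrC addrA subrK. Qed.

Lemma Lq_shift_muln v f r : N (shift (v *+ r) f - f) <= r%:R * N (shift v f - f).
Proof.
elim: r => [|r IH]; first by rewrite mulr0n shift0 subrr Lq0// mul0r.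
rewrite mulrSr shift_telescope; apply: le_trans (LqD q1 _ _) _.
by rewrite Lq_shift -natr1 mulrDl mul1r lerD.
Qed.

(** Twice a masked direction is the sum of two uniformly distributed
    directions, equal on the mask and opposite outside it. *)
Lemma Lq_mask_double A f : sign_free f ->
  N (shift (mask_dir A *+ 2) f - f) <= 2 * increment f.
Proof.
move=> ff.
(* [v] is again uniformly distributed, since [flip A] is a bijection. *)
pose v : signs n -> point := mask_dir fullset \o flip A.
have -> : mask_dir A *+ 2 = mask_dir fullset + v.
  apply/funext => eps; rewrite mulr2n /v /mask_dir !fctE /= -!big_split /=.
  rewrite big_mkcond [RHS]big_mkcond; apply: eq_bigr => j _; rewrite inE.
  rewrite /sign_dir /sign_val ffunE; case: (j \in A) => //.
  by rewrite ssval_neg3 mulrNz subrr.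
rewrite shift_telescope; apply: le_trans (LqD q1 _ _) _.
rewrite Lq_shift mulr_natl mulr2n lerD2l.
pose F (w : signs n * point) := (flip A w.1, w.2).
have FI : injective F.
  by move=> [e x] [e' x'] [/(inv_inj (@flipK n A)) <- <-].
rewrite /increment -(Lq_reindex q (shift (mask_dir fullset) f - f) FI).
apply: Lq_mono => // -[eps x] /=; rewrite !fctE /shift /=.
by rewrite (ff eps (flip A eps)) (ff eps (flip A eps) x).
Qed.

Lemma Lq_walk_dir s f : uniq s -> sign_free f ->
  N (shift (walk_dir m s) f - shift (- walk_dir m s) f) <= 2 * increment f.
Proof.
move=> us ff; rewrite walk_dirE//; set v := mask_dir _.
have -> : shift v f - shift (- v) f = shift (- v) (shift (v *+ 2) f - f).
  by rewrite shiftB shift_shift mulr2n addKr.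
by rewrite Lq_shift; exact: Lq_mask_double.
Qed.

(** * Smoothing by random signs *)

Definition sign_mean r A : fn -> fn :=
  mean (fun (eta : signs n) (_ : signs n) => mask_dir A eta *+ r).

Lemma averaging_sign_mean r A : averaging (sign_mean r A).
Proof. exact: (averaging_mean X (sign_zero n)). Qed.

Lemma sign_free_sign_mean r A g : sign_free g -> sign_free (sign_mean r A g).
Proof.
move=> gf e e' x; rewrite /sign_mean /mean !fctE !fct_sumE; congr (_ *: _).
by apply: eq_bigr => i _; rewrite /shift (gf e e').
Qed.

Lemma natmul_fct (v : signs n -> point) r eps : (v *+ r) eps = v eps *+ r.
Proof. by elim: r => [//|r IH]; rewrite !mulrS fctE IH. Qed.

(** The left-hand side averages over an independent copy of the signs inside the
    norm, the right-hand side outside it: this is Jensen's inequality. *)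
Lemma Lq_sign_mean r A f : sign_free f ->
  N (sign_mean r A f - f) <= N (shift (mask_dir A *+ r) f - f).
Proof.
move=> ff; set g := shift _ f - f.
have s0 : (#|signs n|%:R : R) != 0.
  by rewrite pnatr_eq0 -lt0n; apply/card_gt0P; exists (sign_zero n).
apply: Lq_le => //; first exact: Lq_ge0.
rewrite Lq_pow// !expect_pair; apply: le_expect => x.
rewrite -(expect_cst (sign_zero n) (expect (fun s => `|g (s, x)| `^ q))).
apply: le_expect => eps.
apply: le_trans (powR_expect_le q1 (F := fun s => `|g (s, x)|) _) => //.
apply: ge0_ler_powR; rewrite ?nnegrE//.
- exact: le_trans q1.
- exact: expect_ge0.
have -> : (sign_mean r A f - f) (eps, x) =
    #|signs n|%:R^-1 *: \sum_(eta : signs n) g (eta, x).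
  rewrite /sign_mean /mean !fctE fct_sumE /g.
  under [in RHS]eq_bigr do rewrite !fctE.
  rewrite big_split /= scalerDr; congr (_ *: _ + _).
    apply: eq_bigr => eta _; rewrite /shift /= natmul_fct.
    exact: ff.
  rewrite (eq_bigr (fun=> - f (eps, x))) => [|eta _]; last by rewrite (ff eta eps).
  by rewrite sumr_const -[- f _ *+ _]scaler_nat scalerA mulVf// scale1r.
rewrite normrZ ger0_norm ?invr_ge0// /expect mulrC ler_wpM2r ?invr_ge0//.
exact: ler_norm_sum.
Qed.

Lemma Lq_sign_mean_full r f : sign_free f ->
  N (sign_mean r fullset f - f) <= r%:R * increment f.
Proof.
by move=> ff; apply: le_trans (Lq_sign_mean _ _ ff) _; exact: Lq_shift_muln.
Qed.

Definition sign_mean1 r j : fn -> fn :=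
  mean (fun (a : sign3) (_ : signs n) => basis m j *~ ssval a *+ r).

Lemma sign_mean1E r j g : sign_mean1 r j g =
  3^-1 *: (shift (fun=> - (basis m j *+ r)) g + g + shift (fun=> basis m j *+ r) g).
Proof.
apply/funext => -[eps x]; rewrite /sign_mean1 /mean card_sign3 !fctE fct_sumE.
rewrite (sum_sign3 (fun z => shift (fun=> basis m j *~ z *+ r) g (eps, x))).
by rewrite mulrNz !mulr1z mulr0z mul0rn /shift /= addr0 mulNrn.
Qed.

(** The signs of a uniform vector are independent over the coordinates. *)
Lemma sign_mean_add r A l g : l \notin A ->
  sign_mean1 r l (sign_mean r A g) = sign_mean r (l |: A)%SET g.
Proof.
move=> lA; apply/funext => -[eps x]; rewrite /sign_mean1 /sign_mean /mean.
rewrite card_sign3.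
pose F (a : sign3) (eta : signs n) :=
  g (eps, x + (basis m l *~ ssval a *+ r) + mask_dir A eta *+ r).
have FE a b eta : F a (set_sign eta l b) = F a eta.
  rewrite /F; congr (g (_, _ + _ *+ _)); apply: eq_bigr => j jA.
  by rewrite /sign_dir /sign_val ffunE; case: eqP lA => // <-; rewrite jA.
have third (y : X) : 3^-1 *: (y *+ 3) = y.
  by rewrite -[y *+ 3]scaler_nat scalerA mulVf ?scale1r// pnatr_eq0.
have := sum_resample FE; rewrite !fctE !fct_sumE => FS.
rewrite /shift /= (eq_bigr (fun a => #|signs n|%:R^-1 *: \sum_eta F a eta)).
  rewrite -scaler_sumr FS scalerA mulrC -scalerA third.
  congr (_ *: _); apply: eq_bigr => eta _.
  by rewrite /F mask_dirU1// !fctE mulrnDl addrA.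
by move=> a _.
Qed.

Lemma central_sign_mean1 r j g :
  central (fun=> basis m j *+ r) (sign_mean1 r.*2 j g) =
  3^-1 *: central (fun=> basis m j *+ (3 * r)) g.
Proof.
rewrite sign_mean1E; set b := basis m j.
pose c k : signs n -> point := fun=> b *+ k.
have add_c k l : c k + c l = c (k + l)%N.
  by apply/funext => eps; rewrite /c !fctE mulrnDr.
have r3 : c (3 * r)%N = c r + c r.*2 by rewrite add_c mulSn mul2n.
have r2 : c r.*2 = c r + c r by rewrite add_c addnn.
rewrite /central -/(c r) -/(c (3 * r)%N) -/(c r.*2) -/(- c r.*2).
rewrite !shiftZ !shiftD !shift_shift -scalerBr !scalerA mulrC.
congr (_ *: _).
have -> : c r - c r.*2 = - c r by rewrite r2 opprD addrA subrr add0r.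
have -> : - c r + c r.*2 = c r by rewrite r2 addrA addNr add0r.
rewrite -r3 -opprD -r3 -[X in _ - X]addrA [X in _ - X]addrC opprD addrACA.
by rewrite subrr add0r.
Qed.

(** In one coordinate this is the uniform distribution on 3^a equally spaced
    points, generated by balanced ternary digits; digits uniform in {-1,0,1} keep
    each scale a multiple of the random direction of [increment]. *)
Fixpoint smoother (a r : nat) g : fn :=
  if a is a'.+1 then sign_mean r.*2 fullset (smoother a' (3 * r) g) else g.

Lemma averaging_smoother a r : averaging (smoother a r).
Proof.
elim: a r => [|a IH] r; first exact: averaging_id.
exact: averaging_comp (averaging_sign_mean _ _) (IH _).
Qed.

Lemma sign_free_smoother a r g : sign_free g -> sign_free (smoother a r g).
Proof.
by elim: a r => [//|a IH] r gf; apply: sign_free_sign_mean; exact: IH.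
Qed.

(** One scale telescopes: (u - u^-1)(u^2 + 1 + u^-2) = u^3 - u^-3, where u is the
    translation by [r] in the coordinate [j]. *)
Lemma Lq_central_smoother a r j g :
  N (central (fun=> basis m j *+ r) (smoother a r g)) <= (3 ^+ a)^-1 * N g.
Proof.
elim: a r => [|a IH] r; first by rewrite expr0 invr1 mul1r Lq_central.
have jC : j \notin ([set: 'I_n] :\ j)%SET by rewrite !inE eqxx.
rewrite /= -(finset.setD1K (finset.in_setT j)) -sign_mean_add// central_sign_mean1.
rewrite (LqZ q1) ger0_norm; last by rewrite invr_ge0.
rewrite exprS invfM -mulrA; apply: ler_wpM2l; first by rewrite invr_ge0.
rewrite -(averaging_central (averaging_sign_mean _ _)).
exact: le_trans (Lq_averaging q1 (averaging_sign_mean _ _) _) (IH _).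
Qed.

Lemma Lq_smoother a r f : sign_free f ->
  N (smoother a r f - f) <= (3 ^+ a - 1) * r%:R * increment f.
Proof.
move=> ff; elim: a r => [|a IH] r.
  by rewrite /= expr0 !subrr Lq0// !mul0r.
have avH := averaging_sign_mean r.*2 fullset.
apply: le_trans (Lq_triangle q1 (sign_mean r.*2 fullset f) _ _) _.
rewrite /= -(averagingB avH).
apply: le_trans (lerD (Lq_averaging q1 avH _) (Lq_sign_mean_full _ ff)) _.
apply: le_trans (lerD (IH _) (lexx _)) _.
rewrite -mulrDl ler_wpM2r ?increment_ge0// natrM -mul2n natrM exprS.
by rewrite le_eqVlt; apply/orP; left; apply/eqP; ring.
Qed.

(** The law (1/4, 1/2, 1/4) on {-2, 0, 2} is a mixture of the point mass at 0 and
    of the uniform law, with weights 1/4 and 3/4. *)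
Lemma mid1_mid1 j g : mid1 j (mid1 j g) =
  4^-1 *: g + (3 / 4) *: sign_mean1 2 j g.
Proof.
rewrite sign_mean1E /mid1 /two_point; set b := basis m j.
pose c : signs n -> point := fun=> b; pose d : signs n -> point := fun=> b *+ 2.
have cc : c + c = d by apply/funext => eps; rewrite /c /d !fctE.
have -> : (fun=> - (b *+ 2)) = - d by [].
rewrite -/c -/d !shiftZ !shiftD !shift_shift subrr addNr shift0.
rewrite -opprD cc -scalerDr !scalerA.
have -> : 3 / 4 / 3 = 4^-1 :> R by field.
have -> : 2^-1 * 2^-1 = 4^-1 :> R by rewrite -invfM -natrM.
rewrite -scalerDr; congr (_ *: _); set u := shift d g; set v := shift (- d) g.
by rewrite [u + g]addrC -addrA; congr (_ + _); rewrite [v + g]addrC addrC.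
Qed.

(** One application of [mid1 j \o mid1 j] keeps the mask with probability 1/4
    and adds [j] to it with probability 3/4. *)
Lemma Lq_mid_mask s A f : sign_free f -> uniq s -> {in s, forall j, j \notin A} ->
  N (mid s (sign_mean 2 A f) - f) <= 2 * increment f.
Proof.
move=> ff; elim: s A => [|j s IH] A.
  move=> _ _; apply: le_trans (Lq_sign_mean _ _ ff) _.
  exact: Lq_mask_double.
move=> /andP[js us] sA; have avs := averaging_mid X m s.
have jA : j \notin A by apply: sA; rewrite mem_head.
rewrite /= -!(averagingC avs _ (averaging_mid1 _ _ j)) mid1_mid1.
rewrite sign_mean_add// (averagingD avs) (averagingZ avs 4^-1) (averagingZ avs (3 / 4)).
set g := mid s _; set h := mid s _.
have -> : 4^-1 *: g + (3 / 4) *: h - f = 4^-1 *: (g - f) + (3 / 4) *: (h - f).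
  rewrite !scalerBr addrACA; congr (_ + _).
  by rewrite -opprD -scalerDl (_ : _ + _ = 1) ?scale1r//; field.
apply: le_trans (LqD q1 _ _) _; rewrite !LqZ// !ger0_norm//.
have gb : N (g - f) <= 2 * increment f.
  by apply: IH => // k ks; apply: sA; rewrite inE ks orbT.
have hb : N (h - f) <= 2 * increment f.
  apply: IH => // k ks; rewrite in_setU1 negb_or sA ?inE ?ks ?orbT// andbT.
  by apply: contraNneq js => <-.
move: (N _) (N _) (increment f) gb hb => u v w; lra.
Qed.

Lemma Lq_mid s f : sign_free f -> uniq s -> N (mid s f - f) <= 2 * increment f.
Proof.
move=> ff us; have := Lq_mid_mask (A := finset.set0) ff us.
have -> : sign_mean 2 finset.set0 f = f.
  rewrite /sign_mean /mean (eq_bigr (fun=> f)) => [|eta _]; last first.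
    rewrite /mask_dir finset.big_set0 mul0rn.
    exact: shift0.
  rewrite sumr_const -[f *+ _]scaler_nat scalerA mulVf ?scale1r//.
  by rewrite pnatr_eq0 -lt0n; apply/card_gt0P; exists (sign_zero n).
by apply => j _; rewrite finset.inE.
Qed.

End Increments.

(** * The inequality *)

Lemma power3_between (n : nat) : (0 < n)%N ->
  exists2 a, (n <= 3 ^ a)%N & (3 ^ a <= 3 * n)%N.
Proof.
move=> n0; exists (trunc_log 3 n).+1; first exact/ltnW/trunc_log_ltn.
by rewrite expnS leq_mul2l trunc_logP.
Qed.

Section Assembly.
Variables (R : realType) (q : R) (X : normedModType R) (n m : nat).
Hypothesis q1 : 1 <= q.

Local Notation point := 'rV['Z_m]_n.
Local Notation fn := (signs n * point -> X).
Local Notation N := (@Lq R q X (signs n * point)%type).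

Lemma Lq_sign_free (g : fn) : sign_free g ->
  N g `^ q = expect (fun x : point => `|g (sign_zero n, x)| `^ q).
Proof.
move=> gf; rewrite (Lq_pow q1) expect_pair; apply: eq_expect => x.
rewrite -[RHS](expect_cst (sign_zero n)); apply: eq_expect => eps.
by rewrite (gf eps (sign_zero n)).
Qed.

Lemma cotype_Lq (C : R) (x : 'I_n -> fn) :
  cotype_bound X q C -> (forall j, sign_free (x j)) ->
  \sum_j N (x j) `^ q <=
  C `^ q * N (\sum_j sign_mul (sign_of R j) (x j)) `^ q.
Proof.
move=> [_ cot] xf.
under eq_bigr do rewrite Lq_sign_free//.
rewrite expect_sum (Lq_pow q1) expect_pair -expectZ; apply: le_expect => y.
apply: le_trans (cot _ _) _; rewrite le_eqVlt; apply/orP; left; apply/eqP.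
congr (_ * _); apply: eq_expect => eps; congr (`|_| `^ _).
rewrite fct_sumE; apply: eq_bigr => j _.
by rewrite /sign_mul /= (xf j (sign_zero n) eps).
Qed.

(** A long translation of [f] is compared with that of [h], at the two ends
    only. *)
Lemma Lq_long_shift (f h : fn) (v : signs n -> point) (r : nat) :
  N (shift (v *+ r) f - f) <= 2 * N (h - f) + r%:R * N (shift v h - h).
Proof.
set w := v *+ r; set e := N (h - f).
have e1 : N (shift w f - shift w h) = e.
  by rewrite /e -shiftB Lq_shift -(LqN q1 (h - f)) opprB.
apply: le_trans (Lq_triangle q1 (shift w h) _ _) _; rewrite e1.
apply: le_trans (lerD (lexx e) (Lq_triangle q1 h (shift w h) f)) _.
have e2 := Lq_shift_muln q1 v h r; rewrite -/w in e2.
by move: e2; rewrite -/e; move: (N (shift w h - h)) (r%:R * _) => x y; lra.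
Qed.

Lemma central_twice (j : 'I_n) (h : fn) :
  N (shift (fun=> basis m j *+ 2) h - h) = 2 * N (central1 j h).
Proof.
rewrite /central1 /central (LqZ q1) ger0_norm ?invr_ge0// mulrA mulfV ?pnatr_eq0//.
pose v : signs n -> point := fun=> basis m j.
have vv : (fun=> basis m j *+ 2) = v + v :> (signs n -> point).
  by apply/funext => eps; rewrite /v !fctE.
by rewrite mul1r -/v vv -(Lq_shift q (- v)) shiftB shift_shift addKr.
Qed.

(** The function [h] is [mid s (S (S f))] for [S] the smoother at 3^a: one [S]
    for each factor in the error of the walk, and [mid s] since the linear part of
    the walk produces central differences of [mid s]. *)
Lemma smoothed_function (C : R) (f : fn) (a : nat) :
  cotype_bound X q C -> sign_free f -> (n <= 3 ^ a)%N ->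
  exists h : fn, N (h - f) <= 2 * 3 ^+ a * increment q f /\
    \sum_j N (central1 j h) `^ q <= (C * (4 * increment q f)) `^ q.
Proof.
move=> cot ff na; have q0 : 0 <= q by exact: le_trans q1.
pose S : fn -> fn := smoother a 1; pose s := enum 'I_n.
have us : uniq s := enum_uniq _.
have avS : averaging S := averaging_smoother _ _ _ _ _.
have avs := averaging_mid X m s.
have gf : sign_free (S (S f)) by do 2!apply: sign_free_smoother.
have i0 : 0 <= increment q f := increment_ge0 _ _.
have pa : (0 : R) < 3 ^+ a by rewrite exprn_gt0.
exists (mid s (S (S f))); split.
  have eS : N (S f - f) <= (3 ^+ a - 1) * increment q f.
    by have := Lq_smoother q1 a 1 ff; rewrite mulr1.
  apply: le_trans (Lq_triangle q1 (mid s f) _ _) _.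
  have e1 : N (mid s (S (S f)) - mid s f) <= 2 * (3 ^+ a - 1) * increment q f.
    rewrite -(averagingB avs); apply: le_trans (Lq_averaging q1 avs _) _.
    apply: le_trans (Lq_triangle q1 (S f) _ _) _; rewrite -(averagingB avS).
    apply: le_trans (lerD (Lq_averaging q1 avS _) eS) _.
    by apply: le_trans (lerD eS (lexx _)) _; rewrite -mulrDl -mulr2n mulr_natl.
  apply: le_trans (lerD e1 (Lq_mid q1 ff us)) _.
  by rewrite le_eqVlt; apply/orP; left; apply/eqP; ring.
have [x [xf lE xE]] := linear_part_sum us gf.
apply: (@le_trans _ _ (\sum_j N (x j) `^ q)).
  apply: ler_sum => j _; apply: (ge0_ler_powR q0); [exact: Lq_ge0|exact: Lq_ge0|].
  rewrite -xE; last by rewrite mem_enum.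
  exact: (Lq_averaging q1 (averaging_mid1 _ _ j)).
apply: le_trans (cotype_Lq cot xf) _.
have d4 : 0 <= 4 * increment q f by rewrite mulr_ge0.
rewrite (powRM _ (proj1 cot) d4); apply: ler_wpM2l; first exact: powR_ge0.
apply: (ge0_ler_powR q0 _ d4); first exact: Lq_ge0.
have <- : linear_part s (S (S f)) = \sum_j sign_mul (sign_of R j) (x j).
  by rewrite lE big_enum.
have k0 : 0 <= (3 ^+ a)^-1 :> R by rewrite invr_ge0 ltW.
have d0 : 0 <= 2 * increment q f by rewrite mulr_ge0.
have smooth j g : N (central1 j (S g)) <= (3 ^+ a)^-1 * N g.
  exact: (Lq_central_smoother q1 a 1).
have dir t : uniq t ->
    N (shift (walk_dir m t) f - shift (- walk_dir m t) f) <= 2 * increment q f.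
  by move=> ut; exact: Lq_walk_dir.
apply: le_trans (Lq_linear_part q1 avS k0 d0 smooth dir us) _.
rewrite size_enum_ord.
have c1 : n%:R * (3 ^+ a)^-1 <= 1 :> R.
  by rewrite ler_pdivrMr// mul1r -natrX ler_nat.
have : (n%:R * (3 ^+ a)^-1) ^+ 2 <= 1 :> R by rewrite exprn_ile1// mulr_ge0.
move: (_ ^+ 2) i0 => z; move: (increment q f) => w w0 z1; nra.
Qed.

(** Half the period is crossed in m/4 steps of length 2 along [h]; the cost
    n (n D)^q of passing from f to [h] in every coordinate is at most (m D)^q by
    the lower bound on m. *)
Lemma smoothed_cotype (C : R) (f : fn) : 0 < q ->
  cotype_bound X q C -> sign_free f -> (4 %| m)%N ->
  6 * n%:R `^ (1 + 1 / q) <= m%:R :> R ->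
  \sum_j N (shift (fun=> basis m j *+ (m %/ 2)) f - f) `^ q <=
  4 `^ q * (1 + C `^ q) * (m%:R * increment q f) `^ q.
Proof.
move=> q0 cot ff /dvdnP[k mk] nm.
have [n0|n0] := posnP n.
  rewrite big1 => [|j _]; last by have := ltn_ord j; rewrite [X in (_ < X)%N]n0.
  by rewrite !mulr_ge0 ?addr_ge0 ?powR_ge0.
have [a na an] := power3_between n0.
have [h [hf hc]] := smoothed_function cot ff na.
set d := increment q f in hf hc *; have d0 : 0 <= d := increment_ge0 _ _.
have C0 : 0 <= C := proj1 cot.
have m2 : (m %/ 2 = 2 * k)%N.
  by rewrite mk (_ : k * 4 = k * 2 * 2)%N ?mulnK 1?mulnC//; lia.
have hf' : N (h - f) <= 6 * n%:R * d.
  apply: le_trans hf _; rewrite ler_wpM2r// -natrX -!natrM ler_nat; lia.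
pose b j : signs n -> point := fun=> basis m j *+ 2.
have long j : N (shift (fun=> basis m j *+ (m %/ 2)) f - f) <=
    12 * n%:R * d + m%:R / 2 * N (central1 j h).
  have -> : (fun=> basis m j *+ (m %/ 2)) = b j *+ k.
    by apply/funext => eps; rewrite natmul_fct m2 mulrnA.
  apply: le_trans (Lq_long_shift _ h _ _) _; rewrite /b central_twice.
  have -> : m%:R = k%:R * 4 :> R by rewrite mk natrM.
  have -> : 12 * n%:R * d = 2 * (6 * n%:R * d) by ring.
  have -> : k%:R * 4 / 2 * N (central1 j h) = k%:R * (2 * N (central1 j h)) by field.
  by rewrite lerD2r; move: hf'; move: (N _) => u; move: (6 * _ * _) => z; lra.
have np : (0 : R) < n%:R by rewrite ltr0n.
(* n copies of (n d)^q amount to (n p d)^q, and n p = n^(1 + 1/q). *)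
pose p : R := n%:R `^ q^-1.
have pq : p `^ q = n%:R by rewrite /p -powRrM mulVf ?gt_eqF// powRr1// ltW.
have p0 : 0 <= p := powR_ge0 _ _.
have pm : 6 * (n%:R * p) <= m%:R.
  by move: nm; rewrite div1r powRD ?(gt_eqF np) ?implybT// powRr1// ltW.
have m0 : (0 : R) <= m%:R by [].
have m20 : (0 : R) <= m%:R / 2 by rewrite divr_ge0.
have nd0 : 0 <= 12 * n%:R * d by rewrite !mulr_ge0.
have term j : N (shift (fun=> basis m j *+ (m %/ 2)) f - f) `^ q <=
    2 `^ q * ((12 * n%:R * d) `^ q
              + (m%:R / 2) `^ q * N (central1 j h) `^ q).
  have N0 := Lq_ge0 q (central1 j h).
  rewrite -(powRM _ m20 N0).
  have mN0 : 0 <= m%:R / 2 * N (central1 j h) by rewrite mulr_ge0.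
  apply: le_trans (powR_add_le q1 nd0 mN0).
  apply: (ge0_ler_powR (ltW q0)) (long j); first exact: Lq_ge0.
  exact: addr_ge0 nd0 mN0.
apply: le_trans (ler_sum _ (fun j _ => term j)) _.
rewrite -mulr_sumr big_split /= sumr_const card_ord -mulr_sumr.
have -> : 4 `^ q = 2 `^ q * 2 `^ q :> R by rewrite -powRM// -natrM.
rewrite -!mulrA; apply: ler_wpM2l; first exact: powR_ge0.
have md0 : 0 <= m%:R * d by rewrite mulr_ge0.
rewrite [X in _ <= 2 `^ q * X]mulrDl mul1r mulrDr; apply: lerD.
  have nd1 : 0 <= 12 * (n%:R * d) by rewrite mulrA.
  have two0 : (0 : R) <= 2 by [].
  rewrite -[_ *+ n]mulr_natl -{1}pq -(powRM _ p0 nd1) -(powRM _ two0 md0).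
  apply: (ge0_ler_powR (ltW q0)); rewrite ?nnegrE; [exact: mulr_ge0|exact: mulr_ge0|].
  have -> : p * (12 * (n%:R * d)) = 2 * (6 * (n%:R * p) * d) by ring.
  by rewrite ler_wpM2l// ler_wpM2r.
apply: le_trans (ler_wpM2l (powR_ge0 _ _) hc) _.
have d4 : 0 <= C * (4 * d) by rewrite !mulr_ge0.
have Cd : 0 <= C * (m%:R * d) by rewrite !mulr_ge0.
rewrite -(powRM _ m20 d4) -(powRM _ C0 md0) -(powRM _ _ Cd)//.
have -> : m%:R / 2 * (C * (4 * d)) = 2 * (C * (m%:R * d)) by field.
exact: lexx.
Qed.

End Assembly.

Theorem theorem1p2 (R : realType) (q : R) (hq : 2 <= q) (C : R) :
  exists K : R, 0 < K /\
    forall X : completeNormedModType R,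
      has_cotype X q -> cotype_const X q = C ->
      forall (n m : nat),
        6 * n%:R `^ (1 + 1 / q) <= m%:R :> R -> (4 %| m)%N ->
        forall f : 'rV['Z_m]_n -> X,
          \sum_(j < n) expect (fun x : 'rV['Z_m]_n =>
              `|f (x + (m %/ 2)%:R *: delta_mx 0 j) - f x| `^ q)
          <= K * m%:R `^ q *
             expect (fun p : signs n * 'rV['Z_m]_n =>
               `|f (p.2 + sign_vec m p.1) - f p.2| `^ q).
Proof.
have q1 : 1 <= q by apply: le_trans hq; rewrite ler1n.
have q0 : 0 < q by apply: lt_le_trans q1.
exists (4 `^ q * (1 + C `^ q)); split.
  by rewrite mulr_gt0 ?powR_gt0// ltr_wpDr ?powR_ge0.
move=> X cot CX n m nm m4 f.
have cb := cotype_constP cot; rewrite CX in cb.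
pose F (w : signs n * 'rV['Z_m]_n) : X := f w.2.
have Ff : sign_free F by [].
have incE : increment q F `^ q = expect (fun p : signs n * 'rV['Z_m]_n =>
    `|f (p.2 + sign_vec m p.1) - f p.2| `^ q).
  rewrite /increment mask_dirT (Lq_pow q1); apply: eq_expect => p.
  reflexivity.
have H := smoothed_cotype q1 q0 cb Ff m4 nm.
apply: le_trans (le_trans H _); last first.
  by rewrite (powRM _ (ler0n _ _) (increment_ge0 _ _)) mulrA incE.
apply: ler_sum => j _; rewrite (Lq_sign_free q1)//.
apply: le_expect => x; rewrite le_eqVlt; apply/orP; left; apply/eqP.
by rewrite /F !fctE /shift /= scaler_nat.
Qed.
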